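(* Let $X$ be a normal space. Then $C(X)$ is dense in $(L_0(X),\tau_V)$ and consequently also in $(MC(X),\tau_V)$.
   Context: All topological spaces are assumed Hausdorff and non-empty. A set-valued map $F$ from $X$ to $\mathbb{R}$ is identified with its graph $F\subseteq X\times\mathbb{R}$, with $F(x)=\{y:(x,y)\in F\}$. $F$ is usc if for every $x\in X$ and every open $V\supseteq F(x)$ there is a neighborhood $U$ of $x$ with $F(x')\subseteq V$ for all $x'\in U$. $F$ is cusco if it is usc and $F(x)$ is non-empty, compact and convex for every $x\in X$; it is minimal cusco if it is cusco and every cusco map $G\subseteq F$ satisfies $G=F$. $L_0(X)$ is the set of cusco maps $F\subseteq X\times\mathbb{R}$ such that $F(x)$ is a singleton for every isolated point $x$ of $X$; $MC(X)$ is the set of minimal cusco maps $F\subseteq X\times\mathbb{R}$; $C(X)$ is the set of continuous functions $X\to\mathbb{R}$ (identified with their graphs). One has $C(X)\subseteq MC(X)\subseteq L_0(X)\subseteq CL(X\times\mathbb{R})$, where $CL(X\times\mathbb{R})$ is the set of all non-empty closed subsets of $X\times\mathbb{R}$. The Vietoris topology $\tau_V$ on $CL(X\times\mathbb{R})$ is generated by the subbase of all sets $W^+=\{A:A\subseteq W\}$ and $W^-=\{A:A\cap W\neq\emptyset\}$, $W$ open in $X\times\mathbb{R}$; subsets carry the subspace topology, also denoted $\tau_V$. *)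

(* Defs.v *)
From HB Require Import structures.
From mathcomp Require Import all_boot all_order all_algebra.
From mathcomp Require Import all_classical all_reals all_analysis.
Import Order.TTheory GRing.Theory Num.Theory.
Import numFieldNormedType.Exports.

Set Implicit Arguments.
Unset Strict Implicit.
Unset Printing Implicit Defensive.

Local Open Scope classical_set_scope.
Local Open Scope ring_scope.

Record CL (Y : topologicalType) := MkCL {
  CL_set :> set Y;
  CL_closed : closed CL_set;
  CL_neq0 : CL_set !=set0 }.

Lemma CL_inj (Y : topologicalType) (A B : CL Y) :
  CL_set A = CL_set B -> A = B.
Proof.
case: A B => A cA A0 [B cB B0] /= AB; subst B.
by rewrite (Prop_irrelevance cA cB) (Prop_irrelevance A0 B0).
Qed.

HB.instance Definition _ (Y : topologicalType) := gen_eqMixin (CL Y).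
HB.instance Definition _ (Y : topologicalType) := gen_choiceMixin (CL Y).

Definition vietoris_plus (Y : topologicalType) (W : set Y) : set (CL Y) :=
  [set A | A `<=` W].

Definition vietoris_minus (Y : topologicalType) (W : set Y) : set (CL Y) :=
  [set A | A `&` W !=set0].

Definition vietoris_subbase (Y : topologicalType) : set (set (CL Y)) :=
  [set vietoris_plus W | W in open] `|` [set vietoris_minus W | W in open].

(* The canonical topology of [CL Y] is the Vietoris topology; for
   [S : set (CL Y)], the type [set_type S] then carries the subspace
   topology. *)
HB.instance Definition _ (Y : topologicalType) :=
  isSubBaseTopological.Build (CL Y) (@vietoris_subbase Y) id.

Section cusco.
Context {X : topologicalType} {R : realType}.
Implicit Types F G : set (X * R).

(* [xsection F x] is the value F(x) of the set-valued map with graph F. *)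
Definition usc F := forall (x : X) (V : set R), open V ->
  xsection F x `<=` V -> \forall x' \near x, xsection F x' `<=` V.

Definition cusco F := usc F /\
  forall x : X, [/\ xsection F x !=set0, compact (xsection F x) &
                    convex_set (xsection F x : set R^o)].

Definition minimal_cusco F :=
  cusco F /\ forall G, cusco G -> G `<=` F -> G = F.

Definition fgraph_of (f : X -> R) : set (X * R) := [set p | p.2 = f p.1].

End cusco.

Definition L0 (X : topologicalType) (R : realType) : set (CL (X * R)%type) :=
  [set F | cusco F /\
    forall x, isolated [set: X] x -> exists y, xsection F x = [set y]].

Definition MC (X : topologicalType) (R : realType) : set (CL (X * R)%type) :=
  [set F | minimal_cusco F].

Definition C (X : topologicalType) (R : realType) : set (CL (X * R)%type) :=
  [set F | exists2 f : X -> R, continuous f & CL_set F = fgraph_of f].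

Arguments L0 : clear implicits.
Arguments MC : clear implicits.
Arguments C : clear implicits.

(* Restricting to closed non-empty graphs in [L0], [MC] and [C] loses nothing
   ([cusco_closed], [cusco_neq0]), and the three sets are nested
   ([C_sub_MC], [MC_sub_L0]). *)
Section sanity.
Context {X : topologicalType} {R : realType}.
Implicit Types F G : set (X * R).

Lemma cusco_neq0 F : [set: X] !=set0 -> cusco F -> F !=set0.
Proof.
move=> [x _] [_ /(_ x)[[y]]].
by rewrite /xsection /= inE => Fxy _ _; exists (x, y).
Qed.

Lemma cusco_closed F : cusco F -> closed F.
Proof.
move=> [uF cF]; rewrite -[F]setCK; apply: open_closedC.
rewrite openE => -[x y] /= nFxy.
have [_ /(compact_closed (@Rhausdorff R)) clF _] := cF x.
have : nbhs y (~` xsection F x).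
  apply: open_nbhs_nbhs; split; first exact: closed_openC.
  by rewrite /xsection /= inE.
move=> /nbhs_ballP[e /= e0 ye].
pose V := ~` closed_ball y (e / 2).
have Vop : open V by apply: closed_openC; exact: closed_ball_closed.
have FV : xsection F x `<=` V.
  move=> z Fz yz; apply: (ye z) => //.
  apply: (closed_ball_subset _ _ yz); first by rewrite divr_gt0.
  by rewrite ltr_pdivrMr// ltr_pMr// ltr1n.
exists ([set x' | xsection F x' `<=` V], closed_ball y (e / 2)) => /=.
  split; first exact: uF.
  apply: (filterS (@subset_closed_ball _ _ y (e / 2))).
  by apply: nbhsx_ballx; rewrite divr_gt0.
by move=> -[a b] /= [Fa yb] Fab; apply: (Fa b) => //; rewrite /xsection /= inE.
Qed.

Lemma xsection_fgraph (f : X -> R) x : xsection (fgraph_of f) x = [set f x].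
Proof. by apply/seteqP; split=> y; rewrite /xsection /fgraph_of /= inE. Qed.

Lemma convex_set1 (y : R) : convex_set ([set y] : set R^o).
Proof.
by move=> a b t /set_mem -> /set_mem ->; apply/mem_set; exact: (@convmm _ (convex_lmodType R^o)).
Qed.

Lemma fgraph_cusco (f : X -> R) : continuous f -> cusco (fgraph_of f).
Proof.
move=> cf; split=> [x V oV|x].
  rewrite xsection_fgraph sub1set inE => Vfx.
  have : nbhs x (f @^-1` V) by apply: cf; exact: open_nbhs_nbhs.
  by apply: filterS => x' Vx'; rewrite xsection_fgraph => _ ->.
rewrite xsection_fgraph; split; first by exists (f x).
  exact: compact_set1.
exact: convex_set1.
Qed.

Lemma C_sub_MC : C X R `<=` MC X R.
Proof.
move=> F [f cf /= Ff]; rewrite /MC /= Ff; split; first exact: fgraph_cusco.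
move=> G [_ cG] Gf; apply/seteqP; split=> // -[x z].
rewrite /fgraph_of /= => ->.
have [[y]] := cG x; rewrite /xsection /= inE => Gxy _ _.
by have /= := Gf _ Gxy; rewrite /fgraph_of /= => <-.
Qed.

Lemma MC_sub_L0 : MC X R `<=` L0 X R.
Proof.
move=> F [cF mF]; split=> // x [_ [U Ux]]; rewrite setIT => Ux1; subst U.
have [[y Fxy] _ _] := cF.2 x.
pose G : set (X * R) := [set p | CL_set F p /\ (p.1 = x -> p.2 = y)].
have Gx : xsection G x = [set y].
  apply/seteqP; split=> z; rewrite /xsection /= !inE /G /=.
    by move=> [_]; exact.
  by move=> ->; split=> //; move: Fxy; rewrite /xsection /= inE.
have Gx' x' : x' <> x -> xsection G x' = xsection F x'.
  move=> x'x; apply/seteqP; split=> z; rewrite /xsection /= !inE /G /=.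
    by case.
  by move=> Fz; split.
exists y; rewrite -(mF G) //; last by move=> p [].
split=> [a V oV|a]; have [->|ax] := pselect (a = x).
- by move=> GV; apply: filterS Ux => _ ->.
- rewrite Gx'// => FV.
  have := cF.1 a V oV FV; apply: filterS => b Fb.
  by apply: subset_trans Fb => z; rewrite /xsection /= !inE => -[].
- rewrite Gx; split; [by exists y|exact: compact_set1|].
  exact: convex_set1.
- by rewrite Gx'//; exact: cF.2.
Qed.

End sanity.

(* Main.v *)
Require Import Defs.
From mathcomp Require Import all_boot all_order all_algebra.
From mathcomp Require Import all_classical all_reals all_analysis.
From mathcomp Require Import ring lra.
Import Order.TTheory GRing.Theory Num.Theory.
Import numFieldNormedType.Exports.
Local Open Scope classical_set_scope.

(** A basic Vietoris neighborhood of a cusco graph [F] consists of the closed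
    sets that lie in an open set [W] containing [F] and meet finitely many open
    sets [M], each of which meets [F].  So one needs a continuous function whose
    graph lies in [W] and hits every [M].

    Staying inside [W].  Replace [W] by an open set [strip W F] between [F] and
    [W] whose fibres are intervals ([cusco_sub_strip]); compactness and
    convexity of the values of [F] make this possible.  After compressing the
    line by [atan], the infimum of the fibre of the strip is usc, the minimum of
    [F] is lsc, and the former is below the latter, so the Katetov-Tong
    insertion theorem [usc_lsc_insertion] puts a continuous [h] between them.
    Symmetrically a continuous [k] lies between the maximum of [F] and the
    supremum of the strip.  Then [(h + k) / 2] stays strictly inside the
    strip ([strip_selection]): where [h < k] it is strictly between the bounds
    of the fibre, and where [h = k] the value of [F] is squeezed to that common
    value.  This squeeze takes the place of the theorem inserting a continuous
    function strictly between a usc and a lsc one, which characterizes countably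
    paracompact normal spaces.

    Hitting the sets [M] ([selection_hitting]).  Let [M] contain the point
    [(x, y)] of [F].  If [x] is isolated, [y] is the only value of [F] at [x],
    so [W] can be shrunk above [x] to a part of [M] and the condition becomes
    part of staying inside [W].  If [x] is not isolated, some point near [x] is
    none of those already used for other sets, and a Urysohn function bends the
    selection to the height [y] there, keeping its values at the used points
    ([bend_selection]).

    Minimal cusco maps belong to [L0] and contain the continuous functions, so
    the second density is an instance of the same approximation. *)

(** * Inserting a continuous function between usc and lsc functions *)

Section insertion.
Local Open Scope ring_scope.
Set Implicit Arguments.
Unset Strict Implicit.
Unset Printing Implicit Defensive.
Context {X : topologicalType} {R : realType}.
Implicit Types a b f : X -> R.

Definition usc_fun a :=
  forall x (t : R), a x < t -> \forall y \near x, a y < t.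

Definition lsc_fun b :=
  forall x (t : R), t < b x -> \forall y \near x, t < b y.

Definition almost_between a b (c : R) f :=
  continuous f /\ forall x, a x <= f x + c /\ f x - c <= b x.

Lemma usc_sublevel_open a f (t : R) :
  usc_fun a -> continuous f -> open [set x | a x - f x < t].
Proof.
move=> ua cf; rewrite openE => x /= axt.
pose e := (t - (a x - f x)) / 2.
have e0 : 0 < e by rewrite divr_gt0// subr_gt0.
have aN : \forall y \near x, a y < a x + e by apply: ua; rewrite ltrDl.
have fN : \forall y \near x, `|f x - f y| < e.
  by have /cvgrPdist_lt := cf x; exact.
near=> y => /=.
have : a y < a x + e by near: y.
have : `|f x - f y| < e by near: y.
rewrite ltr_norml /e => /andP[? ?] ?; lra.
Unshelve. all: by end_near. Qed.

Lemma lsc_superlevel_open b f (t : R) :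
  lsc_fun b -> continuous f -> open [set x | t < b x - f x].
Proof.
move=> lb cf.
have uNb : usc_fun (fun x => - b x).
  by move=> x s; rewrite ltrNl => /lb; apply: filterS => y; rewrite ltrNl.
have cNf : continuous (fun x => - f x).
  by move=> x; apply: continuousN; exact: cf.
rewrite [X in open X](_ : _ = [set x | - b x - - f x < - t]).
  exact: usc_sublevel_open.
by apply/seteqP; split=> x /=; lra.
Qed.

(** The step of the proof of Tietze's theorem: the points where [a] exceeds [f]
    by a third of the error and those where [b] is below [f] by a third of it
    form disjoint closed sets because [a <= b], and a Urysohn function of
    amplitude [c / 3] separating them corrects [f]. *)
Lemma insertion_step a b f (c : R) : normal_space X ->
  usc_fun a -> lsc_fun b -> (forall x, a x <= b x) ->
  0 < c -> almost_between a b c f ->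
  exists2 g, almost_between a b (2 / 3 * c) g &
    forall x, `|g x - f x| <= c - 2 / 3 * c.
Proof.
move=> nX ua lb ab c0 [cf abf].
pose high := ~` [set x | a x - f x < c / 3].
pose low := ~` [set x | - (c / 3) < b x - f x].
have low_closed : closed low.
  by apply: open_closedC; exact: lsc_superlevel_open.
have high_closed : closed high.
  by apply: open_closedC; exact: usc_sublevel_open.
have low_high0 : low `&` high = set0.
  rewrite -subset0 => x [/negP + /negP] /=; rewrite -!leNgt => ? ?.
  by have := ab x; lra.
have cc : - (c / 3) < c / 3 by lra.
have [g [cg glow ghigh grange]] :=
  urysohn_ext_itv nX low_closed high_closed low_high0 cc.
have gbound x : - (c / 3) <= g x <= c / 3.
  by have /= := grange (g x); rewrite in_itv; apply; exists x.
exists (fun x => f x + g x).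
  split=> [x|x]; first by apply: continuousD; [exact: cf|exact: cg].
  have [? ?] := abf x; have /andP[? ?] := gbound x; split.
    have [|ax] := ltP (a x - f x) (c / 3); first by lra.
    have -> : g x = c / 3.
      by apply: ghigh; exists x => //; apply/negP; rewrite -leNgt.
    lra.
  have [|bx] := ltP (- (c / 3)) (b x - f x); first by lra.
  have -> : g x = - (c / 3).
    by apply: glow; exists x => //; apply/negP; rewrite -leNgt.
  lra.
move=> x; rewrite [f x + g x]addrC addrK ler_norml.
by have /andP[? ?] := gbound x; apply/andP; split; lra.
Qed.

(** The bound on the increments says that the intervals of center [f_ n x] and
    radius [c n] are nested; they shrink to the value of the limit at [x], which
    is therefore uniform. *)
Lemma almost_between_limit a b (f_ : nat -> X -> R) (c : nat -> R) :
  (forall n, almost_between a b (c n) (f_ n)) ->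
  (forall n x, `|f_ n.+1 x - f_ n x| <= c n - c n.+1) ->
  (forall n, 0 < c n) -> (forall e : R, 0 < e -> exists n, c n < e) ->
  exists2 h, continuous h & forall x, a x <= h x <= b x.
Proof.
move=> abf fstep c_gt0 c_small.
have f_mono x n m : (n <= m)%N ->
    f_ n x - c n <= f_ m x - c m /\ f_ m x + c m <= f_ n x + c n.
  elim: m => [|m IH]; first by rewrite leqn0 => /eqP ->.
  rewrite leq_eqVlt => /predU1P[-> //|]; rewrite ltnS => /IH[? ?].
  by have := fstep m x; rewrite ler_norml => /andP[? ?]; split; lra.
pose S x := range (fun n => f_ n x - c n).
have S_ub x n : ubound (S x) (f_ n x + c n).
  move=> _ [m _ <-]; have [nm|/ltnW mn] := leqP n m.
    by have [_] := f_mono x _ _ nm; have := c_gt0 m; lra.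
  by have [+ _] := f_mono x _ _ mn; have := c_gt0 n; lra.
pose h x := sup (S x).
have h_ge x n : f_ n x - c n <= h x.
  by apply: ub_le_sup; [exists (f_ n x + c n); exact: S_ub|exists n].
have h_le x n : h x <= f_ n x + c n.
  by apply: ge_sup; [exists (f_ 0 x - c 0), 0|exact: S_ub].
exists h => x.
  apply/cvgrPdist_lt => e e0.
  have [n cn] : exists n, c n < e / 3 by apply: c_small; lra.
  have [cf _] := abf n.
  have fN : \forall y \near x, `|f_ n x - f_ n y| < e / 3.
    by have /cvgrPdist_lt := cf x; apply; lra.
  apply: filterS fN => y; rewrite !ltr_norml => /andP[? ?].
  have := h_ge x n; have := h_le x n; have := h_ge y n; have := h_le y n.
  by move=> ? ? ? ?; apply/andP; split; lra.
apply/andP; split; apply/ler_addgt0Pr => e e0.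
  have [n cn] : exists n, c n < e / 2 by apply: c_small; lra.
  by have [_ /(_ x)[]] := abf n; have := h_ge x n; lra.
have [n cn] : exists n, c n < e / 2 by apply: c_small; lra.
by have [_ /(_ x)[]] := abf n; have := h_le x n; lra.
Qed.

(** The Katetov-Tong theorem. The bounds make the zero function a first
    approximation, which [insertion_step] improves geometrically. *)
Theorem usc_lsc_insertion a b (c : R) : normal_space X ->
  usc_fun a -> lsc_fun b -> (forall x, a x <= b x) ->
  (forall x, a x <= c) -> (forall x, - c <= b x) ->
  exists2 h, continuous h & forall x, a x <= h x <= b x.
Proof.
move=> nX ua lb ab ac bc.
(* The initial error has to be positive, which [c] may fail to be. *)
pose d := Num.max c 1; have d0 : 0 < d by rewrite lt_max ltr01 orbT.
have cd : c <= d by rewrite le_max lexx.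
have step (p : (X -> R) * R) : exists q : (X -> R) * R,
    0 < p.2 /\ almost_between a b p.2 p.1 ->
    [/\ q.2 = 2 / 3 * p.2, 0 < q.2, almost_between a b q.2 q.1 &
        forall x, `|q.1 x - p.1 x| <= p.2 - q.2].
  have [[p0 abp]|] := pselect (0 < p.2 /\ almost_between a b p.2 p.1); last first.
    by move=> np; exists p => /np.
  have [g abg gp] := insertion_step nX ua lb ab p0 abp.
  by exists (g, 2 / 3 * p.2) => _; split=> //=; rewrite mulr_gt0// divr_gt0.
have [next nextP] := choice step.
pose s n := iter n next (fun=> 0, d).
have sP n : 0 < (s n).2 /\ almost_between a b (s n).2 (s n).1.
  elim: n => [|n /nextP[_ ? ? _]//].
  split=> //=; split=> [x|x]; first exact: cvg_cst.
  by split; [rewrite add0r (le_trans (ac x))|rewrite sub0r (le_trans _ (bc x))// lerN2].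
apply: (@almost_between_limit a b (fun n => (s n).1) (fun n => (s n).2)).
- by move=> n; have [] := sP n.
- by move=> n x; have [_ _ _] := nextP _ (sP n); exact.
- by move=> n; have [] := sP n.
- have sE n : (s n).2 = geometric d (2 / 3) n.
    elim: n => [|n IH]; first by rewrite /= expr0 mulr1.
    by have [-> _ _ _] := nextP _ (sP n); rewrite -/(s n) IH /= exprS; ring.
  move=> e e0.
  have q1 : `|2 / 3 : R| < 1 by rewrite gtr0_norm; lra.
  have := cvg_geometric d q1 => /(@cvgr0_norm_lt _ R^o) /(_ e e0).
  move=> [n _ /(_ n (leqnn n))] /=; rewrite -[_ * _]/(geometric d _ n) -sE.
  by exists n; apply: le_lt_trans (ler_norm _) _.
Qed.

End insertion.

(** * Continuous selections of a strip around a cusco map *)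

Section selection.
Local Open Scope ring_scope.
Set Implicit Arguments.
Unset Strict Implicit.
Unset Printing Implicit Defensive.
Context {X : topologicalType} {R : realType}.
Implicit Types F S W : set (X * R).

Lemma cusco_min F x : cusco F ->
  exists y, F (x, y) /\ forall z, F (x, z) -> y <= z.
Proof.
move=> [_ /(_ x)[F0 Fc _]].
have [|y] := compact_EVT_min (f := idfun) F0 Fc.
  by apply: continuous_subspaceT => z; exact: cvg_id.
move=> /set_mem/xsectionP Fy ymin; exists y; split=> // z Fz.
by apply: ymin; exact/mem_set/xsectionP.
Qed.

Lemma open_slice S (x : X) (y : R) : open S -> S (x, y) ->
  \forall x' \near x, S (x', y).
Proof.
move=> Sop Sxy; have : nbhs (x, y) S by exact: open_nbhs_nbhs.
move=> [[U V] /= [xU yV] UVS]; apply: filterS xU => x' Ux'.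
by apply: UVS; split => //=; exact: nbhs_singleton.
Qed.

(** Insertion between the infimum of the fibre of [S] and the minimum of [F],
    both read through [atan]: the fibres of [S] may be unbounded below, and
    [F] need not be bounded. The second property of [h] expresses, without
    naming the infimum, that it is at most [h x]. *)
Lemma lower_barrier S F : normal_space X -> open S -> cusco F -> F `<=` S ->
  exists2 h : X -> R, continuous h & forall x,
    (forall y, F (x, y) -> h x <= atan y) /\
    (forall t, h x < t -> exists2 y, S (x, y) & atan y < t).
Proof.
move=> nX Sop cF FS.
have [m mP] := choice (fun x => cusco_min x cF).
pose A x := [set atan y | y in [set y | S (x, y)]].
have A_lb x : has_lbound (A x).
  by exists (- (pi / 2)) => _ [y _ <-]; exact/ltW/atan_gtNpi2.
have A_neq0 x : A x !=set0.
  by exists (atan (m x)), (m x) => //; apply: FS; have [] := mP x.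
pose a x := inf (A x); pose b x := atan (m x).
have ua : usc_fun a.
  move=> x t /(inf_lt (A_neq0 x))[_ [y Sxy <-] yt].
  apply: filterS (open_slice Sop Sxy) => x' Sx'y.
  by apply: le_lt_trans yt; apply: ge_inf => //; exists y.
have lb : lsc_fun b.
  move=> x t txb; have oV : open (atan @^-1` [set z : R | t < z]).
    by apply: open_comp => [z _|]; [exact: continuous_atan|exact: open_gt].
  have FV : xsection F x `<=` atan @^-1` [set z : R | t < z].
    move=> y /xsectionP Fy /=; apply: lt_le_trans txb _.
    by apply: le_atan; have [_] := mP x; exact.
  apply: filterS (cF.1 x _ oV FV) => x' /(_ (m x')); rewrite xsectionE.
  by apply; have [] := mP x'.
have ab x : a x <= b x.
  by apply: ge_inf => //; exists (m x) => //; apply: FS; have [] := mP x.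
have [||h ch hP] := usc_lsc_insertion (c := pi / 2) nX ua lb ab.
- by move=> x; apply: le_trans (ab x) _; exact/ltW/atan_ltpi2.
- by move=> x; exact/ltW/atan_gtNpi2.
exists h => // x; have /andP[ax hb] := hP x; split=> [y Fy|t ht].
  by apply: le_trans hb _; apply: le_atan; have [_] := mP x; exact.
by have [_ [y Sy <-] yt] := inf_lt (A_neq0 x) (le_lt_trans ax ht); exists y.
Qed.

(** Reflection turns the upper half of the argument into the lower one. *)
Definition reflect_graph F : set (X * R) := [set p | F (p.1, - p.2)].

Lemma reflect_cusco F : cusco F -> cusco (reflect_graph F).
Proof.
move=> [uF cF].
have xN x : xsection (reflect_graph F) x = -%R @` xsection F x.
  apply/seteqP; split=> [y /xsectionP Fy|_ [z /xsectionP Fz <-]]; last first.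
    by apply/xsectionP; rewrite /reflect_graph /= opprK.
  by exists (- y); [exact/xsectionP|rewrite opprK].
split=> [x V oV|x].
  rewrite xN image_sub => FV.
  have oNV : open (-%R @^-1` V).
    by apply: open_comp oV => y _; exact: opp_continuous.
  by apply: filterS (uF _ _ oNV FV) => x'; rewrite xN image_sub.
have [F0 Fc Fconv] := cF x; rewrite xN; split.
- exact: image_nonempty.
- apply: continuous_compact Fc; apply: continuous_subspaceT => y.
  exact: opp_continuous.
- move=> a b t /set_mem[a' Fa <-] /set_mem[b' Fb <-].
  have /set_mem Fab := Fconv _ _ t (mem_set Fa) (mem_set Fb).
  apply/mem_set; eexists; first exact: Fab.
  by rewrite /conv /= opprD !scalerN.
Qed.

(** Convexity of the fibres in its order form, which suits inequalities
    better than the barycentric [convex_set]. *)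
Definition convex_valued S := forall x (y1 y2 y : R),
  S (x, y1) -> S (x, y2) -> y1 <= y <= y2 -> S (x, y).

Lemma cusco_convex_valued F : cusco F -> convex_valued F.
Proof.
move=> [_ cF] x a b y Fa Fb /andP[ay yb].
have [ab|ba] := ltP a b; last first.
  by rewrite (_ : y = a)//; apply/eqP; rewrite eq_le; lra.
have ba0 : 0 < b - a by rewrite subr_gt0.
pose t := (b - y) / (b - a).
have t0 : 0 <= t by rewrite divr_ge0//; lra.
have t1 : t <= 1 by rewrite ler_pdivrMr//; lra.
have [_ _ Fconv] := cF x.
have := Fconv a b (Itv01 t0 t1)
  (mem_set ((xsectionP x a F).2 Fa)) (mem_set ((xsectionP x b F).2 Fb)).
move=> /set_mem/xsectionP; congr (F (_, _)).
transitivity (t * a + (1 - t) * b); first by [].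
by rewrite /t; field; rewrite gt_eqF.
Qed.

(** With [- k] the barrier obtained from the reflected graphs, [f] is the
    midpoint of the two barriers. If they differ at [x], the fibre of [S] has
    points on both sides of [f x]; if they agree, the values of [F] at [x],
    caught between them, are all equal to [f x]. *)
Lemma strip_selection S F : normal_space X -> open S -> convex_valued S ->
  cusco F -> F `<=` S ->
  exists2 f : X -> R, continuous f & forall x, S (x, f x).
Proof.
move=> nX Sop Sconv cF FS.
have [h ch hP] := lower_barrier nX Sop cF FS.
have NSop : open (reflect_graph S).
  rewrite (_ : reflect_graph S = (fun p : X * R => (p.1, - p.2)) @^-1` S)//.
  apply: open_comp Sop => p _.
  apply: (@cvg_pair _ _ _ (nbhs p) (nbhs p.1) (nbhs (- p.2))).
    exact: cvg_fst.
  by apply: (@cvgN _ R^o); exact: cvg_snd.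
have NFS : reflect_graph F `<=` reflect_graph S by move=> p; exact: FS.
have [k ck kP] := lower_barrier nX NSop (reflect_cusco cF) NFS.
pose f x := (h x - k x) / 2.
have fP x : exists y, S (x, y) /\ f x = atan y.
  have [hF hS] := hP x; have [kF kS] := kP x.
  have [y [Fy _]] := cusco_min x cF.
  have hy := hF _ Fy.
  have ky : k x <= - atan y.
    by rewrite -atanN; apply: kF; rewrite /reflect_graph /= opprK.
  have [hk|hk] := ltP (h x) (- k x); last first.
    by exists y; split; [exact: FS|rewrite /f; lra].
  have [y1 Sy1 y1f] : exists2 y, S (x, y) & atan y < f x.
    by apply: hS; rewrite /f; lra.
  have [y2 Sy2 y2f] : exists2 y, reflect_graph S (x, y) & atan y < - f x.
    by apply: kS; rewrite /f; lra.
  rewrite ltrNr -atanN in y2f.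
  have tanf : atan (tan (f x)) = f x.
    rewrite tanK// in_itv/= (lt_trans (atan_gtNpi2 _) y1f).
    exact: lt_trans y2f (atan_ltpi2 _).
  exists (tan (f x)); split=> //; apply: Sconv Sy1 Sy2 _.
  apply/andP; split; rewrite leNgt; apply/negP => /lt_atan; rewrite tanf; lra.
exists (tan \o f) => x /=; last by have [y [Sy ->]] := fP x; rewrite atanK.
apply: continuous_comp; last first.
  have [y [_ ->]] := fP x; apply: continuous_tan; rewrite gt_eqF// cos_gt0_pihalf//.
  by rewrite atan_gtNpi2 atan_ltpi2.
by apply: cvgMl; apply: cvgB; [exact: ch|exact: ck].
Qed.

(** The union of the open boxes inside [W] that trap all values of [F] over
    their base. Openness is then immediate, and the fibres are intervals
    because all boxes over a point share the values of [F] there. *)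
Definition strip W F : set (X * R) :=
  [set p | exists ab : R * R, ab.1 < p.2 < ab.2 /\
    \forall x \near p.1, (forall y, F (x, y) -> ab.1 < y < ab.2) /\
                         (forall y, ab.1 < y < ab.2 -> W (x, y))].

Lemma open_strip W F : open (strip W F).
Proof.
rewrite openE => -[x y] /= [[a b] /= [yab xN]].
exists ([set x' | \forall x'' \near x',
    (forall z, F (x'', z) -> a < z < b) /\ (forall z, a < z < b -> W (x'', z))],
  [set z | a < z < b]) => /=.
  split; first exact: nbhs_interior.
  have : y \in `]a, b[ by rewrite in_itv.
  by move=> /near_in_itvoo; apply: filterS => z /=; rewrite in_itv.
by move=> [x' z] /= [x'N zab]; exists (a, b).
Qed.

Lemma strip_sub W F : strip W F `<=` W.
Proof. by move=> [x y] [[a b] /= [yab /nbhs_singleton[_]]]; exact. Qed.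

Lemma convex_valued_strip W F : (forall x, exists y, F (x, y)) ->
  convex_valued (strip W F).
Proof.
move=> F0 x y1 y2 y [[a1 b1] /= [ab1 N1]] [[a2 b2] /= [ab2 N2]] /andP[y1y yy2].
have [z Fz] := F0 x.
have /(_ _ Fz) /andP[? ?] := (nbhs_singleton N1).1.
have /(_ _ Fz) /andP[? ?] := (nbhs_singleton N2).1.
have [yz|zy] := leP y z.
  by exists (a1, b1); split=> //=; apply/andP; split; lra.
by exists (a2, b2); split=> //=; apply/andP; split; lra.
Qed.

(** The tube lemma, with the tube thickened by a uniform margin [e]. *)
Lemma compact_fibre_thicken W F x :
  compact (xsection F x) -> open W -> F `<=` W ->
  exists2 e : R, 0 < e & \forall x' \near x,
    forall y z, F (x, y) -> `|z - y| < e -> W (x', z).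
Proof.
move=> Fc Wop FW.
pose P (i : X * R) y := forall z, `|z - y| < i.2 -> W (i.1, z).
have [y|] := (compact_near_coveringP _).1 Fc (X * R)%type
    (filter_prod (nbhs x) (nbhs (0 : R)^'+)) P _.
  move=> /xsectionP Fy.
  have : nbhs (x, y) W by apply: open_nbhs_nbhs; split=> //; exact: FW.
  move=> [[U V] /= [xU /nbhs_ballP[e /= e0 yV]] UVW].
  exists (ball y (e / 2), U `*` [set d | d < e / 2]) => /=.
    split; first by apply: nbhsx_ballx; rewrite divr_gt0.
    exists (U, [set d | d < e / 2]) => //; split => //=.
    by apply: nbhs_right_lt; rewrite divr_gt0.
  move=> [y' [x' d]] /= [yy' [Ux' de]] z zy'; apply: UVW; split => //=.
  apply: yV; move: yy'; rewrite /ball /= => yy'.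
  have -> : y - z = (y - y') - (z - y') by lra.
  by rewrite (le_lt_trans (ler_normB _ _))//; move: zy' => /=; lra.
move=> [U V] /= [xU V0] UV.
have [e [Ve e0]] : exists e, V e /\ 0 < e.
  have : \forall e \near (0 : R)^'+, V e /\ 0 < e.
    by apply: filterI => //; exact: nbhs_right_gt.
  by move=> /filter_ex.
exists e => //; apply: filterS xU => x' Ux' y z Fy.
by apply: (UV (x', e)) => //; rewrite xsectionE.
Qed.

Lemma cusco_sub_strip W F : cusco F -> open W -> F `<=` W -> F `<=` strip W F.
Proof.
move=> cF Wop FW [x y] Fy.
have [_ Fc _] := cF.2 x.
have [e e0 WN] := compact_fibre_thicken Fc Wop FW.
have [m [Fm mmin]] := cusco_min x cF.
have [M' [FM Mmax]] := cusco_min x (reflect_cusco cF).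
pose M := - M'; have {}Mmax z : F (x, z) -> z <= M.
  by move=> Fz; rewrite lerNr; apply: Mmax; rewrite /reflect_graph /= opprK.
have between z : m < z -> z < M -> F (x, z).
  by move=> mz zM; apply: (cusco_convex_valued cF Fm FM); rewrite !ltW.
exists (m - e, M + e) => /=; split.
  by have := mmin _ Fy; have := Mmax _ Fy => ? ?; apply/andP; split; lra.
have FV : xsection F x `<=` [set z : R | m - e < z < M + e].
  move=> z /xsectionP Fz /=.
  by have := mmin _ Fz; have := Mmax _ Fz => ? ?; apply/andP; split; lra.
have oV : open [set z : R | m - e < z < M + e].
  by rewrite -set_itvoo; exact: interval_open.
have FN := cF.1 x _ oV FV.
near=> x'; split=> z.
  by move=> Fz; apply: (near FN x') => //; rewrite xsectionE.
have WN' : forall y z, F (x, y) -> `|z - y| < e -> W (x', z) by near: x'.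
move=> /andP[? ?]; have mM := Mmax _ Fm.
have [zm|mz] := leP z m; first by apply: (WN' m) => //; rewrite ltr_norml; lra.
have [Mz|zM] := leP M z; first by apply: (WN' M) => //; rewrite ltr_norml; lra.
apply: (WN' z); last by rewrite subrr normr0.
exact: between.
Unshelve. all: by end_near. Qed.

End selection.

(** * Basic neighborhoods in the Vietoris topology *)

Section vietoris.
Set Implicit Arguments.
Unset Strict Implicit.
Unset Printing Implicit Defensive.
Context {Y : topologicalType}.
Implicit Types (F G : CL Y) (W : set Y).

(** The conditions of the first kind are merged into a single one, as
    being included in several sets is being included in their intersection. *)
Definition basic_vietoris W (Ms : seq (set Y)) : set (CL Y) :=
  [set G | G `<=` W /\ forall M, M \in Ms -> G `&` M !=set0].

Lemma subbase_inter_basic F (Us : seq (set (CL Y))) :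
  (forall U, U \in Us -> vietoris_subbase U /\ U F) ->
  exists W Ms, [/\ open W, (forall M, M \in Ms -> open M),
    basic_vietoris W Ms F &
    forall G, basic_vietoris W Ms G -> forall U, U \in Us -> U G].
Proof.
elim: Us => [|U Us IH] UsF.
  by exists setT, [::]; split=> //; exact: openT.
have [U' U'Us|W [Ms [oW oMs [FW FMs] WMs]]] := IH.
  by apply: UsF; rewrite in_cons U'Us orbT.
have [[[V oV <-]|[V oV <-]] UF] := UsF _ (mem_head _ _).
  exists (W `&` V), Ms; split=> //; first exact: openI.
    by split=> // p Fp; split; [exact: FW|exact: UF].
  move=> G [GWV GMs] U'; rewrite in_cons => /predU1P[->|].
    by move=> p /GWV[].
  by apply: WMs; split=> // p /GWV[].
exists W, (V :: Ms); split=> //.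
- by move=> M; rewrite in_cons => /predU1P[->//|]; exact: oMs.
- by split=> // M; rewrite in_cons => /predU1P[->//|]; exact: FMs.
move=> G [GW GMs] U'; rewrite in_cons => /predU1P[->|].
  by apply: GMs; exact: mem_head.
by apply: WMs; split=> // M MMs; apply: GMs; rewrite in_cons MMs orbT.
Qed.

Lemma basic_vietoris_nbhs F (O : set (CL Y)) : open O -> O F ->
  exists W Ms, [/\ open W, (forall M, M \in Ms -> open M),
    basic_vietoris W Ms F & basic_vietoris W Ms `<=` O].
Proof.
move=> oO.
have [Bs BsO <-] : exists2 Bs, Bs `<=` finI_from (@vietoris_subbase Y) id &
  \bigcup_(B in Bs) B = O by exact: oO.
move=> [B BsB BF]; have [D Dsub DB] := BsO _ BsB.
have [U UD|W [Ms [oW oMs WF WG]]] := @subbase_inter_basic F (finmap.enum_fset D).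
  by split; [exact/set_mem/Dsub|move: BF; rewrite -DB; exact].
exists W, Ms; split=> // G /WG DG.
by exists B => //; rewrite -DB => U UD; exact: DG.
Qed.

End vietoris.

(** * Selections meeting prescribed open sets *)

Section density.
Local Open Scope ring_scope.
Set Implicit Arguments.
Unset Strict Implicit.
Unset Printing Implicit Defensive.
Context {X : topologicalType} {R : realType}.
Context (X_hausdorff : hausdorff_space X) (X_normal : normal_space X).
Implicit Types F S W M : set (X * R).

Let closed_point (x : X) : closed [set x].
Proof. exact/accessible_closed_set1/hausdorff_accessible. Qed.

Let closed_seq (D : seq X) : closed [set x | x \in D].
Proof.
apply: (accessible_finite_set_closed.1 (hausdorff_accessible X_hausdorff)).
exact: finite_seq.
Qed.

Lemma convex_valued_path S x (y1 y2 t : R) : convex_valued S ->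
  S (x, y1) -> S (x, y2) -> 0 <= t <= 1 -> S (x, y1 + t * (y2 - y1)).
Proof.
move=> Sconv Sy1 Sy2 /andP[t0 t1]; have [y12|y21] := leP y1 y2.
  by apply: Sconv Sy1 Sy2 _; apply/andP; split; nra.
by apply: Sconv Sy2 Sy1 _; apply/andP; split; nra.
Qed.

(** The new function is a convex combination of [f] and the constant [y], which
    differs from [f] only where [y] itself lies in the fibre of [S]. *)
Lemma bend_selection S (f : X -> R) (D : seq X) x (y : R) :
  open S -> convex_valued S -> continuous f -> (forall z, S (z, f z)) ->
  S (x, y) -> x \notin D ->
  exists g : X -> R, [/\ continuous g, forall z, S (z, g z), g x = y &
    {in D, g =1 f}].
Proof.
move=> Sop Sconv cf Sf Sxy xD.
pose U := [set z | S (z, y)] `&` ~` [set z | z \in D].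
have oU : open U.
  apply: openI; last exact: closed_openC.
  by rewrite openE => z; exact: open_slice.
have UxC0 : ~` U `&` [set x] = set0.
  by rewrite -subset0 => z [/= nU zx]; apply: nU; rewrite zx; split=> //; apply/negP.
have [phi [cphi phi0 phi1 phirange]] :=
  urysohn_ext_itv X_normal (open_closedC oU) (closed_point (x := x)) UxC0 (@ltr01 R).
have phi01 z : 0 <= phi z <= 1.
  by have /= := phirange (phi z); rewrite in_itv; apply; exists z.
have phi_out z : ~ U z -> phi z = 0 by move=> nUz; apply: phi0; exists z.
exists (fun z => f z + phi z * (y - f z)); split.
- move=> z; apply: cvgD; first exact: cf.
  by apply: cvgM; [exact: cphi|apply: cvgB; [exact: cvg_cst|exact: cf]].
- move=> z; have [[Szy _]|nUz] := pselect (U z).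
    exact: convex_valued_path.
  by rewrite phi_out// mul0r addr0.
- by rewrite (phi1 (phi x)) ?mul1r ?subrKC//; exists x.
- by move=> z zD; rewrite phi_out ?mul0r ?addr0// => -[_]; exact.
Qed.

(** Any neighborhood of [x] minus the finitely many points of [D] other than
    [x] is a neighborhood of [x] still, hence not reduced to the point [x]. *)
Lemma nonisolated_avoid (x : X) (U : set X) (D : seq X) :
  ~ isolated [set: X] x -> nbhs x U -> exists2 z, U z & z \notin D.
Proof.
move=> nix Ux; have [xD|xD] := boolP (x \in D); last first.
  by exists x => //; exact: nbhs_singleton.
pose V := U `&` ~` [set z | z \in rem x (undup D)].
have Vx : nbhs x V.
  apply: filterI => //; apply: open_nbhs_nbhs; split.
    exact: closed_openC.
  by move=> /=; rewrite mem_rem_uniq ?undup_uniq// inE eqxx.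
have [z [Uz zD] zx] : exists2 z, V z & z != x.
  apply: contrapT => noz; apply: nix; split; first exact: in_setT.
  exists V => //; rewrite setIT; apply/seteqP; split=> [z Vz|_ ->].
    by apply: contrapT => /eqP zx; apply: noz; exists z.
  exact: nbhs_singleton.
exists z => //; apply/negP => zinD; apply: zD => /=.
by rewrite mem_rem_uniq ?undup_uniq// !inE zx mem_undup.
Qed.

(** Induction on [Ms], for all [W] at once, since an isolated point shrinks [W].
    The strip [S] is part of the conclusion because bending needs interval
    fibres, which such a shrunk [W] does not have; the points of [D] witness the
    sets already hit, so that later bends can leave them alone. *)
Lemma selection_hitting F W (Ms : seq (set (X * R))) : cusco F ->
  (forall x, isolated [set: X] x -> exists y, xsection F x = [set y]) ->
  open W -> F `<=` W ->
  (forall M, M \in Ms -> open M /\ F `&` M !=set0) ->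
  exists S (f : X -> R) (D : seq X),
    [/\ open S, convex_valued S, F `<=` S & S `<=` W] /\
    [/\ continuous f, (forall x, S (x, f x)) &
        forall M, M \in Ms -> exists2 x, x \in D & M (x, f x)].
Proof.
move=> cF Fiso; elim: Ms W => [|M Ms IH] W oW FW MsP.
  have F0 x : exists y, F (x, y) by have [y []] := cusco_min x cF; exists y.
  have FS := cusco_sub_strip cF oW FW.
  have [f cf Sf] := strip_selection X_normal (@open_strip _ _ W F)
    (convex_valued_strip F0) cF FS.
  exists (strip W F), f, [::]; split; last by [].
  split=> //; [exact: open_strip|exact: convex_valued_strip|exact: strip_sub].
have [oM [[x y] [Fxy Mxy]]] := MsP _ (mem_head _ _).
have {}MsP M' : M' \in Ms -> open M' /\ F `&` M' !=set0.
  by move=> M'Ms; apply: MsP; rewrite in_cons M'Ms orbT.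
have [ix|nix] := pselect (isolated [set: X] x).
  (* Above the isolated point [x], only the part of [W] inside [M] is kept. *)
  pose W' := W `&` (~` (fst @^-1` [set x]) `|` M).
  have oW' : open W'.
    apply: openI => //; apply: openU => //; apply: closed_openC.
    by apply: closed_comp (closed_point (x := x)) => p _; exact: cvg_fst.
  have FW' : F `<=` W'.
    move=> [x' y'] Fp; split; first exact: FW.
    have [/= x'x|] := pselect (x' = x); [right|by left].
    have [v Fx] := Fiso x ix.
    have Fv u : F (x, u) -> u = v by move=> /xsectionP; rewrite Fx.
    by rewrite x'x in Fp *; rewrite (Fv _ Fp) -(Fv _ Fxy).
  have [S [f [D [[oS Sconv FS SW'] [cf Sf fD]]]]] := IH W' oW' FW' MsP.
  exists S, f, (x :: D); split; first by split=> // p /SW'[].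
  split=> // M'; rewrite in_cons => /predU1P[->|/fD[x' x'D M'x']].
    by exists x; [exact: mem_head|have [_ [[]|]] := SW' _ (Sf x)].
  by exists x' => //; rewrite in_cons x'D orbT.
have [S [f [D [[oS Sconv FS SW] [cf Sf fD]]]]] := IH W oW FW MsP.
(* [x] may already be in [D], so the bend takes place at a nearby point [z]. *)
have SMx : \forall z \near x, (S `&` M) (z, y).
  by apply: open_slice; [exact: openI|split=> //; exact: FS].
have [z [Szy Mzy] zD] := nonisolated_avoid D nix SMx.
have [g [cg Sg gz gD]] := bend_selection oS Sconv cf Sf Szy zD.
exists S, g, (z :: D); split=> //; split=> // M'.
rewrite in_cons => /predU1P[->|/fD[x' x'D M'x']].
  by exists z; [exact: mem_head|rewrite gz].
by exists x'; [rewrite in_cons x'D orbT|rewrite gD].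
Qed.

End density.

(** * Density of the continuous functions *)

Lemma C_meets_nbhs_L0 {R : realType} {X : topologicalType} (F : CL (X * R)%type)
    (O : set (CL (X * R)%type)) :
  hausdorff_space X -> normal_space X -> L0 X R F -> open O -> O F ->
  O `&` C X R !=set0.
Proof.
move=> hX nX [cF Fiso] oO OF.
have [W [Ms [oW oMs [FW FMs] WO]]] := basic_vietoris_nbhs oO OF.
have MsP M : M \in Ms -> open M /\ F `&` M !=set0.
  by move=> MMs; split; [exact: oMs|exact: FMs].
have [S [f [D [[_ _ _ SW] [cf Sf fMs]]]]] :=
  selection_hitting hX nX cF Fiso oW FW MsP.
have cusco_f := fgraph_cusco cf.
have X0 : [set: X] !=set0 by have [[x _] _] := CL_neq0 F; exists x.
pose G := MkCL (cusco_closed cusco_f) (cusco_neq0 X0 cusco_f).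
exists G; split; last by exists f.
apply: WO; split=> [[x y] /=|M /fMs[x _ Mx]]; first by rewrite /fgraph_of /= => ->; exact/SW/Sf.
by exists (x, f x).
Qed.

Lemma dense_in_subspace {T : topologicalType} (A B : set T) :
  (forall a O, A a -> open O -> O a -> exists2 b, (A `&` B) b & O b) ->
  dense [set a : set_type A | B (set_val a)].
Proof.
move=> AB O [a aU] [U oU UO]; rewrite -UO in aU *.
have [b [Ab Bb] Ub] := AB (set_val a) U (set_valP a) oU aU.
by exists (exist _ b (mem_set Ab)); split.
Qed.

Theorem corollary4p6 (R : realType) (X : topologicalType)
    (X_neq0 : [set: X] !=set0) (X_hausdorff : hausdorff_space X)
    (X_normal : normal_space X) :
  dense [set F : set_type (L0 X R) | C X R (set_val F)] /\
  dense [set F : set_type (MC X R) | C X R (set_val F)].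
Proof.
split; apply: dense_in_subspace => F O AF oO OF.
  have [G [OG CG]] := C_meets_nbhs_L0 X_hausdorff X_normal AF oO OF.
  by exists G => //; split=> //; exact/MC_sub_L0/C_sub_MC.
have [G [OG CG]] := C_meets_nbhs_L0 X_hausdorff X_normal (MC_sub_L0 AF) oO OF.
by exists G => //; split=> //; exact: C_sub_MC.
Qed.
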